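(* Let $s\in\mathbb{Q}$ and let $r$ be a complex number such that $r^2\in\mathbb{Q}\setminus\{0\}$ and $J_s(r)\neq 0$. Then $rJ_{s+1}(r)/J_s(r)$ is irrational, i.e. it does not belong to $\mathbb{Q}$.
   Context: $J_\nu$ denotes the Bessel function of the first kind of order $\nu$, $$J_{\nu}(r)=\sum_{k=0}^{\infty} \frac{(-1)^k}{k!\,\Gamma(\nu+k+1)}\left(\frac{r}{2}\right)^{\nu+2k},$$ where $1/\Gamma(z)$ is interpreted as $0$ when $z$ is a non-positive integer. For non-integer $\nu$ and $r$ not a positive real, the power $(r/2)^{\nu+2k}=(r/2)^{2k}(r/2)^{\nu}$ is taken with a fixed choice of logarithm of $r/2$ (e.g. the principal one), the same for all orders. *)

(* Defs.v *)
From Stdlib Require Import Reals QArith Qreals ZArith Lra Lia.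
From Coquelicot Require Import Coquelicot.
Open Scope R_scope.

(* Euler's integral of the second kind; only meaningful for 0 < x. *)
Definition Euler_integral (x : R) : R :=
  RInt_gen (fun t => Rpower t (x - 1) * exp (- t))
    (at_right 0) (Rbar_locally p_infty).

Fixpoint rising (x : R) (n : nat) : R :=
  match n with
  | O => 1
  | S m => rising x m * (x + INR m)
  end.

(* Gamma on the real line: Euler's integral for 0 < x, extended by
   Gamma x = Gamma (x + n) / (x (x + 1) ... (x + n - 1)), where n is the least
   natural number with 0 < x + n (so n = 0 when 0 < x).  At a non-positive
   integer the product vanishes and the value is meaningless. *)
Definition Gamma (x : R) : R :=
  let n := Z.to_nat (up (- x)) in
  Euler_integral (x + INR n) / rising x n.

(* 1 / Gamma, with value 0 at the non-positive integers. *)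
Definition rGamma (x : R) : R :=
  if Rlt_dec 0 x then / Gamma x
  else if Req_EM_T (frac_part x) 0 then 0 else / Gamma x.

Definition Cexp (z : C) : C :=
  (exp (Re z) * cos (Im z), exp (Re z) * sin (Im z)).

(* L picks a logarithm of every nonzero complex number, the real one on the
   positive reals; the value of L at 0 is irrelevant. *)
Definition log_choice (L : C -> C) : Prop :=
  (forall z : C, z <> 0%C -> Cexp (L z) = z) /\
  (forall x : R, 0 < x -> L (RtoC x) = RtoC (ln x)).

Definition principal_log (z : C) : C :=
  (ln (Cmod z),
   if Rlt_dec (Im z) 0 then - acos (Re z / Cmod z) else acos (Re z / Cmod z)).

Lemma principal_log_choice : log_choice principal_log.
Proof.
split.
- intros [a b] Hz.
  assert (Hm : 0 < Cmod (a, b)) by now apply Cmod_gt_0.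
  assert (Hsq : Cmod (a, b) * Cmod (a, b) = a * a + b * b).
  { generalize (Cmod2_alt (a, b)); simpl; lra. }
  unfold Cexp, principal_log; simpl.
  set (m := Cmod (a, b)) in *.
  rewrite (exp_ln m Hm).
  assert (Hu : -1 <= a / m <= 1).
  { assert (H : Rabs a <= m) by exact (re_le_Cmod (a, b)).
    apply Rabs_le_between in H.
    split; [apply Rle_div_r | apply Rle_div_l]; lra. }
  assert (Hs : m * sqrt (1 - Rsqr (a / m)) = Rabs b).
  { rewrite <- (sqrt_Rsqr m) at 1 by lra.
    rewrite <- sqrt_mult_alt by apply Rle_0_sqr.
    rewrite <- sqrt_Rsqr_abs. f_equal. unfold Rsqr.
    replace (b * b) with (m * m - a * a) by lra. field. lra. }
  destruct (Rlt_dec b 0) as [Hb | Hb].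
  + rewrite cos_neg, sin_neg, cos_acos, sin_acos by exact Hu.
    replace (m * - sqrt (1 - Rsqr (a / m)))
      with (- (m * sqrt (1 - Rsqr (a / m)))) by ring.
    rewrite Hs, Rabs_left by lra.
    f_equal; [field; lra | ring].
  + rewrite cos_acos, sin_acos by exact Hu.
    rewrite Hs, Rabs_right by lra.
    f_equal. field; lra.
- intros x Hx. unfold principal_log.
  rewrite Cmod_R, Rabs_right by lra. simpl.
  destruct (Rlt_dec 0 0) as [H | _]; [lra |].
  replace (x / x) with 1 by (field; lra).
  now rewrite acos_1.
Qed.

(* Coquelicot's total Series is real-valued only. *)
Definition CSeries (a : nat -> C) : C :=
  (Series (fun k => Re (a k)), Series (fun k => Im (a k))).

Lemma CSeries_unique (a : nat -> C) (l : C) :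
  is_series (V := C_R_NormedModule) a l -> CSeries a = l.
Proof.
assert (Hsum : forall n, sum_n (G := C_R_NormedModule) a n =
  (sum_n (fun k => Re (a k)) n, sum_n (fun k => Im (a k)) n)).
{ induction n as [| n IH].
  - rewrite !sum_O. apply surjective_pairing.
  - rewrite !sum_Sn, IH. now destruct (a (S n)). }
intros H. destruct l as [l1 l2]. unfold CSeries.
f_equal; apply is_series_unique; intros P [e He];
  destruct (H (fun z => ball (l1, l2) e z)) as [N HN];
  try (now exists e);
  exists N; intros n Hn; apply He;
  generalize (HN n Hn); rewrite Hsum; intros [H1 H2]; assumption.
Qed.

(* J_nu(r) for r <> 0, relative to the choice L of logarithm:
   (r/2)^(nu+2k) is (r/2)^(2k) * exp (nu * L (r/2)). *)
Definition besselJ (L : C -> C) (nu : R) (r : C) : C :=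
  CSeries (fun k : nat =>
    (RtoC ((-1) ^ k / INR (fact k) * rGamma (nu + INR k + 1))
     * (Cpow (r / 2) (2 * k) * Cexp (RtoC nu * L (r / 2))))%C).

Definition rational (z : C) : Prop := exists q : Q, z = RtoC (Q2R q).

(* Main.v *)
(* Write x = r^2 / 4 and J_nu(r) = (r / 2)^nu f_nu, so that
   r J_(s+1)(r) / J_s(r) = 2 x f_(s+1) / f_s.  The recurrence
   f_nu = (nu + 1) f_(nu+1) - x f_(nu+2) computes f_(s+n) from f_s and f_(s+1)
   with denominators that grow only geometrically in n when s and x are
   rational, whereas f_(s+n) decays like 1 / Gamma (s + n + 1).  If
   f_(s+1) / f_s were rational, a multiple of (b p)^n f_(s+n) would be a
   sequence of integers tending to 0, hence eventually 0, and running the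
   recurrence backwards would give f_s = 0. *)
Require Import Defs.
From Stdlib Require Import Reals QArith Qreals ZArith Lra Lia.
From Coquelicot Require Import Coquelicot.
Open Scope R_scope.

(** * Convergence of Euler's integral *)

(** For nonnegative [f] the integral over [[a, b]] grows with the interval, so the limit is the
    supremum of these integrals. *)
Lemma improper_integral_exists (f : R -> R) (M : R) :
  (forall t, 0 < t -> continuous f t) ->
  (forall t, 0 < t -> 0 <= f t) ->
  (forall a b, 0 < a -> a <= b -> RInt f a b <= M) ->
  exists l, is_RInt_gen f (at_right 0) (Rbar_locally p_infty) l.
Proof.
intros Hc Hpos HM.
assert (Hex : forall a b, 0 < a -> 0 < b -> ex_RInt f a b).
{ intros a b Ha Hb. apply (ex_RInt_continuous (V := R_CompleteNormedModule)). intros z [Hz _]. apply Hc.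
  generalize (Rmin_glb_lt a b 0 Ha Hb); lra. }
assert (Hmono : forall a a' b b', 0 < a' -> a' <= a -> a <= b -> b <= b' ->
  RInt f a b <= RInt f a' b').
{ intros a a' b b' H1 H2 H3 H4.
  rewrite <- (RInt_Chasles f a' a b') by (apply Hex; lra).
  rewrite <- (RInt_Chasles f a b b') by (apply Hex; lra).
  assert (0 <= RInt f a' a).
  { apply RInt_ge_0; [lra | apply Hex; lra | intros; apply Hpos; lra]. }
  assert (0 <= RInt f b b').
  { apply RInt_ge_0; [lra | apply Hex; lra | intros; apply Hpos; lra]. }
  unfold plus; simpl; lra. }
destruct (completeness (fun v => exists a b, 0 < a /\ a <= b /\ v = RInt f a b))
  as [l [Hub Hlub]].
{ exists M. intros v (a & b & Ha & Hab & ->). now apply HM. }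
{ exists (RInt f 1 1), 1, 1. lra. }
exists l. apply filterlimi_locally. intros eps.
destruct (Classical_Prop.classic
  (exists a b, 0 < a /\ a <= b /\ l - eps < RInt f a b))
  as [(a0 & b0 & Ha0 & Hab0 & Hl) | Hno].
- apply (Filter_prod _ _ _ (fun a => 0 < a <= a0) (fun b => b0 < b)).
  + exists (mkposreal a0 Ha0). intros y Hy Hy0.
    apply Rabs_lt_between' in Hy; simpl in Hy. lra.
  + now exists b0.
  + intros a b [Ha Ha'] Hb. exists (RInt f a b). split.
    * apply (RInt_correct (V := R_CompleteNormedModule)), Hex; simpl; lra.
    * assert (RInt f a0 b0 <= RInt f a b) by (apply Hmono; lra).
      assert (RInt f a b <= l) by (apply Hub; exists a, b; lra).
      apply Rabs_lt_between'. generalize (cond_pos eps); lra.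
- exfalso. assert (l <= l - eps); [| generalize (cond_pos eps); lra].
  apply Hlub. intros v (a & b & Ha & Hab & ->).
  apply Rnot_lt_le. intros H. apply Hno. now exists a, b.
Qed.

(** This is [ln y <= y - 1] at [y = (1 + t) / c]; it says that [(1 + t)^c * exp (- t)] is at most
    [c^c]. *)
Lemma ln_1_plus_le (c t : R) :
  1 <= c -> 0 < t -> c * ln (1 + t) <= t + c * ln c.
Proof.
intros Hc Ht.
assert (H0 : 0 < (1 + t) / c) by (apply Rdiv_lt_0_compat; lra).
assert (H : ln ((1 + t) / c) <= t / c).
{ apply Rle_trans with ((1 + t) / c - 1).
  - generalize (exp_ineq1_le (ln ((1 + t) / c))). rewrite exp_ln by exact H0. lra.
  - assert (/ c <= 1) by (rewrite <- Rinv_1; apply Rinv_le_contravar; lra).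
    unfold Rdiv; lra. }
unfold Rdiv in H at 1.
rewrite ln_mult, ln_Rinv in H; try lra; [| apply Rinv_0_lt_compat; lra].
apply (Rmult_le_compat_l c) in H; [| lra].
replace (c * (t / c)) with t in H by (field; lra). lra.
Qed.

Lemma Gamma_integrand_continuous (x t : R) :
  0 < t -> continuous (fun t => Rpower t (x - 1) * exp (- t)) t.
Proof.
intros Ht. apply (ex_derive_continuous (V := R_NormedModule)).
unfold Rpower. auto_derive. exact Ht.
Qed.

(* Up to a constant the integrand is dominated by the derivative of the
   bounded function (t / (1 + t)) ^ x. *)
Lemma Euler_integral_exists (x : R) :
  0 < x ->
  exists l, is_RInt_gen (fun t => Rpower t (x - 1) * exp (- t))
    (at_right 0) (Rbar_locally p_infty) l.
Proof.
intros Hx.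
set (G := fun t => exp (x * (ln t - ln (1 + t)))).
(* The derivative of [G] is [x t^(x-1) / (1+t)^(x+1)], so [g] is
   [(x+1)^(x+1) t^(x-1) / (1+t)^(x+1)], which dominates the integrand by [ln_1_plus_le] with
   [c = x + 1]. *)
set (K := exp ((x + 1) * ln (x + 1)) / x).
set (g := fun t => K * (G t * (x * (/ t - / (1 + t))))).
assert (HK : 0 < K) by (apply Rdiv_lt_0_compat; [apply exp_pos | exact Hx]).
assert (HG : forall t, 0 < t -> 0 < G t < 1).
{ intros t Ht. split; [apply exp_pos |].
  rewrite <- exp_0. apply exp_increasing.
  assert (ln t < ln (1 + t)) by (apply ln_increasing; lra). nra. }
apply improper_integral_exists with K.
- intros t Ht. now apply Gamma_integrand_continuous.
- intros t _. apply Rmult_le_pos; apply Rlt_le, exp_pos.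
- intros a b Ha Hab.
  assert (Hg : is_RInt g a b (K * G b - K * G a)).
  { apply (is_RInt_derive (fun t => K * G t)).
    - intros t [Ht _]. rewrite Rmin_left in Ht by lra. unfold g, G.
      auto_derive; [lra |]. unfold Rminus. ring.
    - intros t [Ht _]. rewrite Rmin_left in Ht by lra.
      apply (ex_derive_continuous (V := R_NormedModule)).
      unfold g, G. auto_derive. lra. }
  apply Rle_trans with (RInt g a b).
  + apply RInt_le; [exact Hab | | eexists; exact Hg |].
    * apply (ex_RInt_continuous (V := R_CompleteNormedModule)). intros t [Ht _].
      rewrite Rmin_left in Ht by lra. apply Gamma_integrand_continuous. lra.
    * intros t Ht.
      assert (E : g t = exp ((x + 1) * ln (x + 1) + (x - 1) * ln t
                             - (x + 1) * ln (1 + t))).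
      { unfold g, G, K.
        replace ((x + 1) * ln (x + 1) + (x - 1) * ln t - (x + 1) * ln (1 + t))
          with ((x + 1) * ln (x + 1) + (x * (ln t - ln (1 + t)) + - ln t + - ln (1 + t)))
          by ring.
        rewrite !exp_plus, !exp_Ropp, !exp_ln by lra. field. lra. }
      rewrite E. unfold Rpower. rewrite <- exp_plus.
      assert (H := ln_1_plus_le (x + 1) t ltac:(lra) ltac:(lra)).
      destruct (Req_dec ((x - 1) * ln t + - t)
        ((x + 1) * ln (x + 1) + (x - 1) * ln t - (x + 1) * ln (1 + t)))
        as [-> | Hne]; [lra |].
      apply Rlt_le, exp_increasing. lra.
  + rewrite (is_RInt_unique _ _ _ _ Hg).
    generalize (HG a Ha) (HG b ltac:(lra)). nra.
Qed.

(** * Functional equation of Gamma and of its reciprocal *)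

Lemma Rpower_mul_exp_opp_lim_0 (x : R) :
  0 < x ->
  filterlim (fun t => Rpower t x * exp (- t)) (at_right 0) (locally 0).
Proof.
intros Hx. apply filterlim_locally. intros eps.
(* The radius is [eps^(1/x)]; the factor [exp (- t)] is below 1. *)
exists (mkposreal _ (exp_pos (ln eps / x))). intros t Ht Ht0.
apply Rabs_lt_between' in Ht; simpl in Ht.
apply Rabs_lt_between'. unfold Rpower. rewrite <- exp_plus.
assert (H : exp (x * ln t + - t) < eps).
{ rewrite <- (exp_ln eps) by apply cond_pos. apply exp_increasing.
  assert (H : ln t < ln eps / x).
  { rewrite <- (ln_exp (ln eps / x)). apply ln_increasing; lra. }
  apply (Rmult_lt_compat_l x) in H; [| exact Hx].
  replace (x * (ln eps / x)) with (ln eps) in H by (field; lra). lra. }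
generalize (exp_pos (x * ln t + - t)) (cond_pos eps). lra.
Qed.

Lemma Rpower_mul_exp_opp_lim_p_infty (x : R) :
  0 < x ->
  filterlim (fun t => Rpower t x * exp (- t)) (Rbar_locally p_infty) (locally 0).
Proof.
intros Hx. apply filterlim_locally. intros eps.
(* By [ln_1_plus_le] with [c = x + 1], [x ln t - t < (x+1) ln (x+1) - ln t], and beyond this
   threshold the right side is below [ln eps]. *)
exists (exp ((x + 1) * ln (x + 1) - ln eps)). intros t Ht.
assert (Ht0 : 0 < t) by (eapply Rlt_trans; [apply exp_pos | exact Ht]).
apply Rabs_lt_between'. unfold Rpower. rewrite <- exp_plus.
assert (H : exp (x * ln t + - t) < eps).
{ rewrite <- (exp_ln eps) by apply cond_pos. apply exp_increasing.
  assert (H1 := ln_1_plus_le (x + 1) t ltac:(lra) Ht0).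
  assert (H2 : (x + 1) * ln (x + 1) - ln eps < ln t).
  { rewrite <- (ln_exp (_ - _)). apply ln_increasing; [apply exp_pos | exact Ht]. }
  assert (H3 : ln t < ln (1 + t)) by (apply ln_increasing; lra).
  nra. }
generalize (exp_pos (x * ln t + - t)) (cond_pos eps). lra.
Qed.

(** Integration by parts: the integrand for [x + 1] is [x] times the one for [x] plus the derivative
    of [B], and [B] tends to 0 at both ends. *)
Lemma Euler_integral_rec (x : R) :
  0 < x -> Euler_integral (x + 1) = x * Euler_integral x.
Proof.
intros Hx. unfold Euler_integral.
destruct (Euler_integral_exists x Hx) as [l Hl].
rewrite (is_RInt_gen_unique (V := R_CompleteNormedModule) _ _ Hl).
apply (is_RInt_gen_unique (V := R_CompleteNormedModule)).
set (B := fun t => - (Rpower t x * exp (- t))).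
assert (Hder : forall t, 0 < t -> is_derive B t
  (Rpower t x * exp (- t) - x * (Rpower t (x - 1) * exp (- t)))).
{ intros t Ht. unfold B, Rpower. auto_derive; [exact Ht |].
  replace ((x - 1) * ln t) with (x * ln t + - ln t) by ring.
  rewrite exp_plus, (exp_Ropp (ln t)), exp_ln by exact Ht. field. lra. }
(* What holds at every positive point holds throughout [[a, b]] for all endpoints that matter to the
   improper integral. *)
assert (Hloc : forall P : R -> Prop, (forall t, 0 < t -> P t) ->
  filter_prod (at_right 0) (Rbar_locally p_infty) (fun ab =>
    forall t, Rmin (fst ab) (snd ab) <= t <= Rmax (fst ab) (snd ab) -> P t)).
{ intros P HP. apply (Filter_prod _ _ _ (fun a => 0 < a) (fun b => 0 < b)).
  - exists (mkposreal 1 Rlt_0_1). now intros.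
  - now exists 0.
  - intros a b Ha Hb t [Ht _]. apply HP. simpl in Ht.
    generalize (Rmin_glb_lt a b 0 Ha Hb); lra. }
assert (HB : is_RInt_gen (Derive B) (at_right 0) (Rbar_locally p_infty) (0 - 0)).
{ apply is_RInt_gen_Derive.
  - apply Hloc. intros t Ht. eexists. now apply Hder.
  - apply Hloc. intros t Ht.
    apply continuous_ext_loc with
      (fun t => Rpower t x * exp (- t) - x * (Rpower t (x - 1) * exp (- t))).
    + exists (mkposreal t Ht). intros y Hy.
      apply Rabs_lt_between' in Hy; simpl in Hy.
      symmetry. apply is_derive_unique, Hder. lra.
    + apply (ex_derive_continuous (V := R_NormedModule)).
      unfold Rpower. auto_derive. lra.
  - replace 0 with (- 0) at 2 by ring.
    apply (filterlim_comp _ _ _ (fun t => Rpower t x * exp (- t)) Ropp _ (locally 0));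
      [now apply Rpower_mul_exp_opp_lim_0 |].
    apply (filterlim_opp (V := R_NormedModule)).
  - replace 0 with (- 0) by ring.
    apply (filterlim_comp _ _ _ (fun t => Rpower t x * exp (- t)) Ropp _ (locally 0));
      [now apply Rpower_mul_exp_opp_lim_p_infty |].
    apply (filterlim_opp (V := R_NormedModule)). }
apply (is_RInt_gen_scal _ x) in Hl.
assert (H := is_RInt_gen_plus _ _ _ _ Hl HB).
change (plus (scal x l) (0 - 0)) with (x * l + (0 - 0)) in H.
rewrite Rminus_0_r, Rplus_0_r in H.
revert H. apply is_RInt_gen_ext.
generalize (Hloc (fun t => plus (scal x (Rpower t (x - 1) * exp (- t))) (Derive B t)
  = Rpower t (x + 1 - 1) * exp (- t))).
intros H. eapply filter_imp; [| apply H].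
- intros ab Hab t Ht. apply Hab. lra.
- intros t Ht. rewrite (is_derive_unique _ _ _ (Hder t Ht)).
  replace (x + 1 - 1) with x by ring.
  unfold plus, scal; simpl; unfold mult; simpl. ring.
Qed.

Lemma rising_succ_l (x : R) (n : nat) : rising x (S n) = x * rising (x + 1) n.
Proof.
induction n as [| n IH]; [simpl; ring |].
change (rising x (S n) * (x + INR (S n)) = x * (rising (x + 1) n * (x + 1 + INR n))).
rewrite IH, S_INR. ring.
Qed.

(** For negative [x] the shift [n] of [x] exceeds that of [x + 1] by one, so both sides use Euler's
    integral at the same point and the products differ by the factor [x]. *)
Lemma Gamma_rec (x : R) : x <> 0 -> Gamma (x + 1) = x * Gamma x.
Proof.
intros Hx. unfold Gamma.
destruct (archimed (- x)) as [H1 H2].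
destruct (Rlt_dec 0 x) as [Hp | Hn].
- destruct (archimed (- (x + 1))) as [H3 H4].
  (* For positive [x] both values of [up] are at most 0, and [Z.to_nat] sends them to 0. *)
  assert (E : forall z, IZR z < 1 -> Z.to_nat z = 0%nat).
  { intros z Hz. apply lt_IZR in Hz. lia. }
  rewrite (E (up (- x))), (E (up (- (x + 1)))) by lra.
  simpl. rewrite !Rplus_0_r, !Rdiv_1_r. now apply Euler_integral_rec.
- assert (E : up (- x) = Z.succ (up (- (x + 1)))).
  { symmetry. apply tech_up; rewrite succ_IZR;
      destruct (archimed (- (x + 1))); lra. }
  assert (Hz : (0 <= up (- (x + 1)))%Z).
  { assert (0 < up (- x))%Z by (apply lt_IZR; lra). lia. }
  rewrite E, Z2Nat.inj_succ by exact Hz.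
  rewrite rising_succ_l, S_INR.
  replace (x + 1 + INR (Z.to_nat (up (- (x + 1)))))
    with (x + (INR (Z.to_nat (up (- (x + 1)))) + 1)) by ring.
  unfold Rdiv. rewrite Rinv_mult.
  (* The product vanishes when [x] is a negative integer, so its inverse is treated as an arbitrary
     number. *)
  generalize (/ rising (x + 1) (Z.to_nat (up (- (x + 1))))). intros y. now field.
Qed.

Lemma frac_part_succ (x : R) : frac_part (x + 1) = frac_part x.
Proof.
symmetry. apply (Int_part_frac_part_spec _ (Int_part x + 1)).
- generalize (base_fp x); lra.
- rewrite plus_IZR. generalize (Rplus_Int_part_frac_part x); lra.
Qed.

(** The convention at the poles makes this true at every real [x]: both sides are 0 at the
    non-positive integers. *)
Lemma rGamma_rec (x : R) : rGamma x = x * rGamma (x + 1).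
Proof.
destruct (Req_dec x 0) as [-> | Hx].
{ unfold rGamma. rewrite fp_R0.
  destruct (Rlt_dec 0 0); [lra |]. destruct (Req_EM_T 0 0); lra. }
assert (E : / Gamma x = x * / Gamma (x + 1)).
{ rewrite Gamma_rec, Rinv_mult by exact Hx. generalize (/ Gamma x). intros y. now field. }
unfold rGamma. rewrite frac_part_succ, E.
destruct (Rlt_dec 0 x), (Rlt_dec 0 (x + 1)); try lra.
(* Here [-1 < x <= 0]; the only integer in this range is 0, which was treated above. *)
- destruct (Req_EM_T (frac_part x) 0) as [H |]; [| reflexivity].
  apply fp_nat in H. destruct H as [c ->].
  rewrite <- plus_IZR in r. apply lt_IZR in r.
  assert (c = 0)%Z as -> by (apply Z.le_antisymm; [apply Z.nlt_ge; intros Hc; apply IZR_lt in Hc; lra | lia]).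
  now elim Hx.
- destruct (Req_EM_T (frac_part x) 0); ring.
Qed.

(** * Decay of the reciprocal Gamma function *)

Lemma eventually_decreasing_bounded (v : nat -> R) (N : nat) :
  (forall n, (N <= n)%nat -> v (S n) <= v n) -> exists M, forall n, v n <= M.
Proof.
revert v. induction N as [| N IH]; intros v Hv.
- exists (v 0%nat). induction n as [| n IHn]; [lra |].
  apply Rle_trans with (v n); [apply Hv; lia | exact IHn].
- destruct (IH (fun n => v (S n))) as [M HM]; [intros; apply Hv; lia |].
  exists (Rmax (v 0%nat) M). intros [| n]; [apply Rmax_l |].
  eapply Rle_trans; [apply HM | apply Rmax_r].
Qed.

(** By [rGamma_rec], passing from [n] to [n + 1] multiplies the left side by [D / (nu + n + 1)],
    which is at most 1 once [n] exceeds [D - nu]. *)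
Lemma rGamma_decay (nu D : R) :
  0 < D -> exists M, forall n, Rabs (rGamma (nu + INR n + 1)) * D ^ n <= M.
Proof.
intros HD. destruct (nfloor_ex (Rmax 0 (D - nu)) (Rmax_l _ _)) as [N HN].
apply (eventually_decreasing_bounded _ (S N)). intros n Hn.
apply le_INR in Hn. rewrite S_INR in Hn.
assert (Hnu : D <= nu + INR n + 1) by (generalize (Rmax_r 0 (D - nu)); lra).
rewrite (rGamma_rec (nu + INR n + 1)), S_INR, Rabs_mult.
replace (nu + (INR n + 1) + 1) with (nu + INR n + 1 + 1) by ring.
rewrite (Rabs_pos_eq (nu + INR n + 1)) by lra. simpl.
assert (H : 0 <= Rabs (rGamma (nu + INR n + 1 + 1)) * D ^ n).
{ apply Rmult_le_pos; [apply Rabs_pos | apply pow_le; lra]. }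
apply (Rmult_le_compat_r _ _ _ H) in Hnu. lra.
Qed.

(** * The Bessel power series: convergence, recurrence, decay in the order *)

Definition bessel_term (x nu : R) (k : nat) : R :=
  (-1) ^ k / INR (fact k) * rGamma (nu + INR k + 1) * x ^ k.

(* J_nu (r) = (r / 2) ^ nu * bessel_sum (r ^ 2 / 4) nu *)
Definition bessel_sum (x nu : R) : R := Series (bessel_term x nu).

Lemma is_series_exp (M x : R) :
  is_series (fun k => M * (x ^ k / INR (fact k))) (M * exp x).
Proof.
apply (is_series_scal M (fun k => x ^ k / INR (fact k))).
generalize (is_exp_Reals x). apply is_series_ext. intros k.
rewrite pow_n_pow. unfold scal; simpl; unfold mult; simpl. reflexivity.
Qed.

Lemma bessel_term_bound (x nu M : R) :
  (forall k, Rabs (rGamma (nu + INR k + 1)) <= M) ->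
  forall k, Rabs (bessel_term x nu k) <= M * (Rabs x ^ k / INR (fact k)).
Proof.
intros HM k. unfold bessel_term, Rdiv.
assert (Hf := INR_fact_lt_0 k).
rewrite !Rabs_mult, pow_1_abs, <- RPow_abs.
rewrite Rabs_pos_eq by (apply Rlt_le, Rinv_0_lt_compat, Hf).
rewrite Rmult_1_l, (Rmult_comm (/ _)), Rmult_assoc, (Rmult_comm (/ _)).
apply Rmult_le_compat_r; [| apply HM].
apply Rmult_le_pos; [apply pow_le, Rabs_pos | apply Rlt_le, Rinv_0_lt_compat, Hf].
Qed.

(** Comparison with the exponential series. The bound is linear in [M], so decay of the reciprocal
    Gamma values carries over to the sum. *)
Lemma bessel_sum_bound (x nu M : R) :
  (forall k, Rabs (rGamma (nu + INR k + 1)) <= M) ->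
  ex_series (bessel_term x nu) /\ Rabs (bessel_sum x nu) <= M * exp (Rabs x).
Proof.
intros HM. assert (Hb := bessel_term_bound x nu M HM).
assert (He := is_series_exp M (Rabs x)).
assert (Hs : ex_series (fun k => Rabs (bessel_term x nu k))).
{ apply (ex_series_le (V := R_CompleteNormedModule) _
    (fun k => M * (Rabs x ^ k / INR (fact k)))).
  - intros k. unfold norm; simpl; unfold abs; simpl. rewrite Rabs_Rabsolu. apply Hb.
  - eexists. exact He. }
split; [now apply ex_series_Rabs |].
eapply Rle_trans; [now apply Series_Rabs |].
rewrite <- (is_series_unique _ _ He). apply Series_le; [| eexists; exact He].
intros k. split; [apply Rabs_pos | apply Hb].
Qed.

Lemma ex_series_bessel_term (x nu : R) : ex_series (bessel_term x nu).
Proof.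
destruct (rGamma_decay nu 1 Rlt_0_1) as [M HM].
apply (bessel_sum_bound x nu M). intros k.
specialize (HM k). rewrite pow1 in HM. lra.
Qed.

(** In each term the reciprocal Gamma value yields a factor [nu + k + 1]. The part [nu + 1] gives
    the series of order [nu + 1]; the part [k] cancels against [k!] and, after an index shift, gives
    [- x] times the series of order [nu + 2]. *)
Lemma bessel_sum_rec (x nu : R) :
  bessel_sum x nu = (nu + 1) * bessel_sum x (nu + 1) - x * bessel_sum x (nu + 2).
Proof.
set (b := fun k => bessel_term x nu k - (nu + 1) * bessel_term x (nu + 1) k).
assert (Hb : forall k, b k =
  INR k * ((-1) ^ k / INR (fact k) * rGamma (nu + INR k + 2) * x ^ k)).
{ intros k. unfold b, bessel_term. rewrite (rGamma_rec (nu + INR k + 1)).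
  replace (nu + INR k + 1 + 1) with (nu + INR k + 2) by ring.
  replace (nu + 1 + INR k + 1) with (nu + INR k + 2) by ring.
  field. apply INR_fact_neq_0. }
assert (H : Series b = - x * bessel_sum x (nu + 2)).
{ rewrite Series_incr_1_aux by (rewrite Hb; simpl; ring).
  unfold bessel_sum. rewrite <- Series_scal_l. apply Series_ext. intros k.
  rewrite Hb. unfold bessel_term. rewrite fact_simpl, mult_INR, S_INR.
  replace (nu + (INR k + 1) + 2) with (nu + 2 + INR k + 1) by ring.
  simpl. field. split; [apply INR_fact_neq_0 | generalize (pos_INR k); lra]. }
assert (H' : Series b = bessel_sum x nu - (nu + 1) * bessel_sum x (nu + 1)).
{ unfold b, bessel_sum. rewrite Series_minus.
  - now rewrite Series_scal_l.
  - apply ex_series_bessel_term.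
  - apply (ex_series_scal (V := R_NormedModule)), ex_series_bessel_term. }
lra.
Qed.

Lemma bessel_sum_decay (x nu D : R) :
  0 < D -> is_lim_seq (fun n => D ^ n * bessel_sum x (nu + INR n)) 0.
Proof.
(* As [E >= 1], the bound [M / E^(n+k)] is at most [M / E^n] for all [k]; the factor 2 leaves a
   surplus [(1/2)^n] over [D^n]. *)
intros HD. set (E := 2 * Rmax 1 D).
assert (HE : 1 <= Rmax 1 D /\ D <= Rmax 1 D) by (split; [apply Rmax_l | apply Rmax_r]).
destruct (rGamma_decay nu E ltac:(unfold E; lra)) as [M HM].
assert (HEn : forall n, 0 < E ^ n) by (intros; apply pow_lt; unfold E; lra).
apply is_lim_seq_abs_0.
apply is_lim_seq_le_le with (fun _ => 0) (fun n => M * exp (Rabs x) * (/ 2) ^ n).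
- intros n. split; [apply Rabs_pos |].
  destruct (bessel_sum_bound x (nu + INR n) (M / E ^ n)) as [_ H].
  { intros k. apply Rle_div_r; [apply HEn |].
    eapply Rle_trans; [| apply (HM (n + k)%nat)].
    rewrite plus_INR, Rplus_assoc. rewrite pow_add.
    replace (nu + (INR n + INR k) + 1) with (nu + (INR n + (INR k + 1))) by ring.
    replace (nu + INR n + (INR k + 1)) with (nu + (INR n + (INR k + 1))) by ring.
    apply Rmult_le_compat_l; [apply Rabs_pos |].
    rewrite <- (Rmult_1_r (E ^ n)) at 1.
    apply Rmult_le_compat_l; [apply Rlt_le, HEn | apply pow_R1_Rle; unfold E; lra]. }
  rewrite Rabs_mult, Rabs_pos_eq by (apply pow_le; lra).
  apply Rle_trans with ((Rmax 1 D) ^ n * (M / E ^ n * exp (Rabs x))).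
  + apply Rmult_le_compat; [apply pow_le; lra | apply Rabs_pos | | exact H].
    apply pow_incr; lra.
  + unfold E. rewrite Rpow_mult_distr, pow_inv. right. field.
    split; apply pow_nonzero; lra.
- apply is_lim_seq_const.
- replace (Finite 0) with (Rbar_mult (M * exp (Rabs x)) 0)
    by (simpl; f_equal; ring).
  apply is_lim_seq_scal_l, is_lim_seq_geom. rewrite Rabs_pos_eq; lra.
Qed.

(** * Irrationality from a second-order recurrence and fast decay *)

(* Here s = a / b and x = p / q, and (b p)^n u n is an integer multiple of
   c = u 0 / k. *)
Lemma recurrence_ratio_irrational (u : nat -> R) (a b p q : Z) :
  IZR b <> 0 -> IZR p <> 0 -> IZR q <> 0 ->
  (forall n, u n = (IZR a / IZR b + INR n + 1) * u (S n) - IZR p / IZR q * u (S (S n))) ->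
  is_lim_seq (fun n => Rabs (IZR b * IZR p) ^ n * u n) 0 ->
  u 0%nat <> 0 ->
  forall m k : Z, IZR k <> 0 -> u 1%nat / u 0%nat <> IZR m / IZR k.
Proof.
intros Hb Hp Hq Hrec Hlim Hu0 m k Hk Hmk.
set (c := u 0%nat / IZR k). set (D := IZR b * IZR p) in *.
assert (HD : D <> 0) by (apply Rmult_integral_contrapositive; auto).
assert (Hc : c <> 0).
{ unfold c, Rdiv. apply Rmult_integral_contrapositive. split; [exact Hu0 |].
  now apply Rinv_neq_0_compat. }
(* Two consecutive terms are carried along because the recurrence has order two; it starts from
   [u 0 = c k] and [u 1 = c m]. *)
assert (Hint : forall n, (exists z, D ^ n * u n = c * IZR z) /\
                         (exists z, D ^ S n * u (S n) = c * IZR z)).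
{ induction n as [| n [[z Hz] [w Hw]]]; split; auto.
  - exists k. unfold c. simpl. now field.
  - exists (b * p * m)%Z. rewrite !mult_IZR. simpl. fold D.
    assert (E : u 1%nat = c * IZR m).
    { unfold c. transitivity (u 1%nat / u 0%nat * u 0%nat); [now field |].
      rewrite Hmk. now field. }
    rewrite E. ring.
  - now exists w.
  (* Solve the recurrence for [u (n + 2)] and multiply by [D^(n+2)]: one factor [D = b p] clears the
     denominators [p] and [b]. *)
  - exists (q * ((a + (Z.of_nat n + 1) * b) * w - b * (b * p) * z))%Z.
    rewrite !mult_IZR, minus_IZR, !mult_IZR, plus_IZR, mult_IZR, plus_IZR.
    rewrite <- INR_IZR_INZ. fold D.
    transitivity (IZR q * ((IZR a + (INR n + 1) * IZR b) * (c * IZR w)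
                  - IZR b * D * (c * IZR z))); [| ring].
    rewrite <- Hw, <- Hz. simpl.
    transitivity (D ^ n * D * IZR b * IZR q * (IZR p / IZR q * u (S (S n)))).
    { unfold D at 1. now field. }
    replace (IZR p / IZR q * u (S (S n)))
      with ((IZR a / IZR b + INR n + 1) * u (S n) - u n) by (rewrite (Hrec n); ring).
    now field. }
(* An integer multiple of [c] that is smaller than [c] in absolute value is 0. *)
assert (Hev : exists N, forall n, (N <= n)%nat -> u n = 0).
{ apply is_lim_seq_spec in Hlim.
  assert (Hc' : 0 < Rabs c) by now apply Rabs_pos_lt.
  destruct (Hlim (mkposreal _ Hc')) as [N HN]. exists N. intros n Hn.
  specialize (HN n Hn). simpl in HN. rewrite Rminus_0_r, Rabs_mult in HN.
  rewrite <- RPow_abs, Rabs_Rabsolu, RPow_abs, <- Rabs_mult in HN.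
  destruct (Hint n) as [[z Hz] _]. rewrite Hz, Rabs_mult in HN.
  assert (z = 0)%Z as ->.
  { rewrite <- abs_IZR in HN.
    assert (IZR (Z.abs z) < 1) as H by nra. apply lt_IZR in H. lia. }
  rewrite Rmult_0_r in Hz. apply Rmult_integral in Hz.
  destruct Hz as [Hz |]; [| assumption]. now apply (pow_nonzero D n) in HD. }
destruct Hev as [N HN]. apply Hu0.
(* The recurrence gives each term from the next two, so the zeros propagate down to index 0. *)
assert (Hback : forall i n, (N <= n + i)%nat -> u n = 0).
{ induction i as [| i IH]; intros n Hn; [apply HN; lia |].
  rewrite Hrec, (IH (S n)), (IH (S (S n))) by lia. ring. }
now apply (Hback N).
Qed.

(** * From the complex Bessel function to the real series *)

Lemma Cexp_plus (z w : C) : Cexp (z + w)%C = (Cexp z * Cexp w)%C.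
Proof.
destruct z as [a b], w as [c d]. unfold Cexp; simpl.
rewrite exp_plus, cos_plus, sin_plus. unfold Cmult; simpl. f_equal; ring.
Qed.

Lemma CSeries_scal (a : nat -> R) (z : C) :
  CSeries (fun k => (RtoC (a k) * z)%C) = (RtoC (Series a) * z)%C.
Proof.
unfold CSeries.
rewrite (Series_ext (fun k => Re _) (fun k => a k * Re z)) by (intros; apply re_scal_l).
rewrite (Series_ext (fun k => Im _) (fun k => a k * Im z)) by (intros; apply im_scal_l).
rewrite !Series_scal_r. rewrite <- re_scal_l, <- im_scal_l.
symmetry. apply surjective_pairing.
Qed.

(** Only even powers of [r / 2] occur in the series, and they are the real numbers [x^k]; the
    exponential is a common complex factor. *)
Lemma besselJ_bessel_sum (L : C -> C) (nu x : R) (r : C) :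
  Cpow r 2 = RtoC (4 * x) ->
  besselJ L nu r = (RtoC (bessel_sum x nu) * Cexp (RtoC nu * L (r / 2)))%C.
Proof.
intros Hx. unfold bessel_sum. rewrite <- CSeries_scal. unfold besselJ. f_equal.
apply FunctionalExtensionality.functional_extensionality. intros k.
assert (E : Cpow (r / 2) (2 * k) = RtoC (x ^ k)).
{ rewrite Cpow_mult_r, RtoC_pow. f_equal.
  transitivity (Cpow r 2 / 4)%C; [simpl; field | rewrite Hx, RtoC_mult; field]. }
rewrite E. unfold bessel_term. rewrite !RtoC_mult. ring.
Qed.

Theorem theorem2 (L : C -> C) (s : Q) (r : C) :
  log_choice L ->
  rational (Cpow r 2) ->
  Cpow r 2 <> 0%C ->
  besselJ L (Q2R s) r <> 0%C ->
  ~ rational (r * besselJ L (Q2R s + 1) r / besselJ L (Q2R s) r)%C.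
Proof.
intros [HL _] [t Ht] Hr HJ [v Hv].
set (x := Q2R t / 4).
assert (Hx : Cpow r 2 = RtoC (4 * x)) by (rewrite Ht; unfold x; f_equal; field).
assert (Hr0 : (r / 2)%C <> 0%C).
{ intros H. apply Hr. replace r with (2 * (r / 2))%C by field.
  rewrite H. simpl. ring. }
rewrite (besselJ_bessel_sum L _ x r Hx) in HJ.
rewrite !(besselJ_bessel_sum L _ x r Hx) in Hv.
(* Raising the order by 1 multiplies the exponential by [Cexp (L (r / 2)) = r / 2], so [E] cancels
   in the quotient. *)
replace (RtoC (Q2R s + 1) * L (r / 2)%C)%C
  with (RtoC (Q2R s) * L (r / 2)%C + L (r / 2)%C)%C in Hv by (rewrite RtoC_plus; ring).
rewrite Cexp_plus, (HL _ Hr0) in Hv.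
set (E := Cexp (RtoC (Q2R s) * L (r / 2)%C)%C) in *.
assert (HE : E <> 0%C) by (intros H; apply HJ; rewrite H; ring).
assert (Hf0 : bessel_sum x (Q2R s) <> 0) by (intros H; apply HJ; rewrite H; ring).
assert (Hx0 : x <> 0).
{ intros H. apply Hr. rewrite Hx, H. f_equal. ring. }
(* The factor [r * (r / 2)] equals [2 x]. *)
assert (Hratio : bessel_sum x (Q2R s + 1) / bessel_sum x (Q2R s) = Q2R v / (2 * x)).
{ apply RtoC_inj. assert (2 * x <> 0) by lra.
  rewrite !RtoC_div, <- Hv, RtoC_mult by assumption.
  assert (RtoC (bessel_sum x (Q2R s)) <> 0%C) by (intros H'; apply Hf0, RtoC_inj, H').
  assert (RtoC x <> 0%C) by (intros H'; apply Hx0, RtoC_inj, H').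
  transitivity (Cpow r 2 * RtoC (bessel_sum x (Q2R s + 1))
    / (4 * RtoC x * RtoC (bessel_sum x (Q2R s))))%C.
  - rewrite Hx, RtoC_mult. field. auto.
  - simpl. field. auto. }
assert (Hden : forall y, IZR (QDen y) <> 0) by (intros y; apply eq_IZR_contrapositive; lia).
assert (Hnum : IZR (Qnum t) <> 0).
{ intros H. apply Hx0. unfold x, Q2R. rewrite H. field. apply Hden. }
revert Hratio.
replace (Q2R v / (2 * x))
  with (IZR (Qnum v * 2 * QDen t) / IZR (QDen v * Qnum t)).
2: { unfold x, Q2R. rewrite !mult_IZR. field. auto. }
(* The denominator becomes the term at index 0 of the sequence [bessel_sum x (s + n)]; [x = t / 4]
   accounts for the 4 in [q]. *)
rewrite <- (Rplus_0_r (Q2R s)) at 2.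
apply (recurrence_ratio_irrational (fun n => bessel_sum x (Q2R s + INR n))
  (Qnum s) (QDen s) (Qnum t) (4 * QDen t)); auto.
- rewrite mult_IZR. apply Rmult_integral_contrapositive. split; [lra | auto].
- intros n. rewrite (bessel_sum_rec x (Q2R s + INR n)), !S_INR.
  replace (IZR (Qnum t) / IZR (4 * QDen t)) with x
    by (unfold x, Q2R; rewrite mult_IZR; field; auto).
  fold (Q2R s). rewrite <- !Rplus_assoc.
  replace (Q2R s + INR n + 2) with (Q2R s + INR n + 1 + 1) by ring. reflexivity.
- apply bessel_sum_decay, Rabs_pos_lt, Rmult_integral_contrapositive. auto.
- simpl. now rewrite Rplus_0_r.
- rewrite mult_IZR. apply Rmult_integral_contrapositive. auto.
Qed.
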